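(* Let $\Omega\subseteq\mathbb C^{n+m}$ be a domain which is $n$-star-shaped Hartogs in $(z_1,\dots,z_n)$, with points written $(z,z')$, $z'\in\mathbb C^m$. Let $\alpha_j>0$ and $\gamma_j>0$ for $1\le j\le n$, and let $$U^\alpha=\Big\{(z,z',w)\in\mathbb C^{n+m}\times\mathbb C:\Big(\tfrac{z_1}{(1-|w|^2)^{\alpha_1/2}},\dots,\tfrac{z_n}{(1-|w|^2)^{\alpha_n/2}},z'\Big)\in\Omega,\ |w|<1\Big\},$$ $$V^\gamma=\Big\{(z,z',w)\in\mathbb C^{n+m}\times\mathbb C:\big(e^{\gamma_1|w|^2/2}z_1,\dots,e^{\gamma_n|w|^2/2}z_n,z'\big)\in\Omega\Big\}.$$ Then $U^\alpha$ and $V^\gamma$ are $(n+1)$-star-shaped Hartogs in the variables $(z_1,\dots,z_n,w)$.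
   Context: A domain is $n$-star-shaped Hartogs in a set of $n$ of its complex variables $(u_1,\dots,u_n)$ if, whenever a point belongs to it, so does every point obtained by replacing each $u_j$ by $\lambda_ju_j$ with $\lambda_j\in\mathbb C$, $|\lambda_j|\le1$, keeping the other coordinates fixed. *)

(* Defs.v *)
From mathcomp Require Import all_boot all_order all_algebra.
From mathcomp Require Import all_classical all_reals all_analysis.
From mathcomp Require Export complex.
Import Order.TTheory GRing.Theory Num.Theory.

Set Implicit Arguments.
Unset Strict Implicit.
Unset Printing Implicit Defensive.

Local Open Scope ring_scope.
Local Open Scope classical_set_scope.

Definition cabs (R : realType) (u : R[i]) : R := ComplexField.Normc.normc u.

(* A point of C^(n+m) is written (z, z') with z : C^n, z' : C^m. *)
Definition pt (R : realType) (n m : nat) := (('I_n -> R[i]) * ('I_m -> R[i]))%type.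

(* openness in C^(n+m) for the usual (sup-norm, equivalently Euclidean) topology *)
Definition copen (R : realType) (n m : nat) (A : set (pt R n m)) : Prop :=
  forall p, A p -> exists2 e : R, 0 < e &
    forall q : pt R n m,
      (forall j, cabs (q.1 j - p.1 j) < e) ->
      (forall k, cabs (q.2 k - p.2 k) < e) -> A q.

Definition cconnected (R : realType) (n m : nat) (D : set (pt R n m)) : Prop :=
  forall A B : set (pt R n m), copen A -> copen B ->
    D `<=` A `|` B -> D `&` A `&` B = set0 ->
    D `&` A = set0 \/ D `&` B = set0.

Definition cdomain (R : realType) (n m : nat) (D : set (pt R n m)) : Prop :=
  D !=set0 /\ copen D /\ cconnected D.

Definition star_hartogs_z (R : realType) (n m : nat) (D : set (pt R n m)) : Prop :=
  forall (z : 'I_n -> R[i]) (z' : 'I_m -> R[i]) (lam : 'I_n -> R[i]),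
    (forall j, cabs (lam j) <= 1) ->
    D (z, z') -> D (fun j => lam j * z j, z').

Definition star_hartogs_zw (R : realType) (n m : nat)
    (D : set (pt R n m * R[i])) : Prop :=
  forall (z : 'I_n -> R[i]) (z' : 'I_m -> R[i]) (w : R[i])
         (lam : 'I_n -> R[i]) (mu : R[i]),
    (forall j, cabs (lam j) <= 1) -> cabs mu <= 1 ->
    D ((z, z'), w) -> D ((fun j => lam j * z j, z'), mu * w).

Definition Ualpha (R : realType) (n m : nat) (Om : set (pt R n m))
    (alpha : 'I_n -> R) : set (pt R n m * R[i]) :=
  [set p | let: ((z, z'), w) := p in
     cabs w < 1 /\
     Om (fun j => z j / ((1 - cabs w ^+ 2) `^ (alpha j / 2))%:C%C, z')].

Definition Vgamma (R : realType) (n m : nat) (Om : set (pt R n m))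
    (gamma : 'I_n -> R) : set (pt R n m * R[i]) :=
  [set p | let: ((z, z'), w) := p in
     Om (fun j => (expR (gamma j * cabs w ^+ 2 / 2))%:C%C * z j, z')].

(* Main.v *)
Require Import Defs.
From mathcomp Require Import all_boot all_order all_algebra.
From mathcomp Require Import all_classical all_reals all_analysis.
From mathcomp Require Import complex.
Import Order.TTheory GRing.Theory Num.Theory.
Local Open Scope ring_scope.
Local Open Scope classical_set_scope.

(* Both sets are preimages of Omega under maps z_j |-> c_j(|w|) z_j with positive
   real factors c_j that are nondecreasing in |w|.  Replacing (z, w) by
   (lam z, mu w) with |lam_j|, |mu| <= 1 thus multiplies the z_j-coordinate of
   the preimage point by lam_j c_j(|mu w|) / c_j(|w|), a number of modulus at most
   1, so the Hartogs property of Omega in z applies. *)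

Section Modulus.
Context {R : realType}.
Implicit Types (u v : R[i]) (r : R).

Lemma cabs_ge0 u : 0 <= cabs u.
Proof. by case: u => a b; exact: sqrtr_ge0. Qed.

Lemma cabsM u v : cabs (u * v) = cabs u * cabs v.
Proof. exact: ComplexField.Normc.normcM. Qed.

Lemma cabs_real r : cabs r%:C%C = `|r|.
Proof. by rewrite /cabs /= expr0n /= addr0 sqrtr_sqr. Qed.

Lemma cabsM_le u v : cabs u <= 1 -> cabs (u * v) <= cabs v.
Proof. by move=> u_le1; rewrite cabsM ler_piMl ?cabs_ge0. Qed.

Lemma sqr_cabsM_le u v : cabs u <= 1 -> cabs (u * v) ^+ 2 <= cabs v ^+ 2.
Proof. by move=> u_le1; rewrite ler_sqr ?nnegrE ?cabs_ge0 ?cabsM_le. Qed.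

End Modulus.

Section StarHartogs.
Context {R : realType} {n m : nat} {Om : set (pt R n m)}.
Hypothesis Om_star : star_hartogs_z Om.

Lemma star_hartogs_z_shrink {z : 'I_n -> R[i]} {z' : 'I_m -> R[i]}
    {lam : 'I_n -> R[i]} {c d : 'I_n -> R} :
  (forall j, cabs (lam j) <= 1) ->
  (forall j, 0 < c j) -> (forall j, 0 <= d j <= c j) ->
  Om (fun j => (c j)%:C%C * z j, z') ->
  Om (fun j => (d j)%:C%C * (lam j * z j), z').
Proof.
move=> lam_le1 c_gt0 d_le_c Omcz.
have ratio_le1 j : cabs (lam j * (d j / c j)%:C%C) <= 1.
  have /andP[d_ge0 d_le] := d_le_c j.
  have ratio_ge0 : 0 <= d j / c j by rewrite divr_ge0 // ltW.
  rewrite cabsM cabs_real ger0_norm //.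
  by apply: mulr_ile1; rewrite ?cabs_ge0 // ler_pdivrMr // mul1r.
suff -> : (fun j => (d j)%:C%C * (lam j * z j))
        = (fun j => lam j * (d j / c j)%:C%C * ((c j)%:C%C * z j)).
  exact: Om_star ratio_le1 Omcz.
apply: funext => j.
have cC_neq0 : (c j)%:C%C != 0 by rewrite (inj_eq (@complexI _)) gt_eqF.
by rewrite rmorphM /= fmorphV /= mulrCA -!mulrA mulKf.
Qed.

Lemma star_hartogs_zw_Ualpha (alpha : 'I_n -> R) :
  (forall j, 0 <= alpha j) -> star_hartogs_zw (Ualpha Om alpha).
Proof.
move=> alpha_ge0 z z' w lam mu lam_le1 mu_le1 [w_lt1 Omz].
have mw2_le := sqr_cabsM_le mu w mu_le1.
have w2_lt1 : cabs w ^+ 2 < 1 by rewrite expr_lt1 ?cabs_ge0.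
have mw2_lt1 : cabs (mu * w) ^+ 2 < 1 by exact: le_lt_trans w2_lt1.
pose c j := ((1 - cabs w ^+ 2) `^ (alpha j / 2))^-1.
pose d j := ((1 - cabs (mu * w) ^+ 2) `^ (alpha j / 2))^-1.
have c_gt0 j : 0 < c j by rewrite invr_gt0 powR_gt0 // subr_gt0.
have d_le_c j : 0 <= d j <= c j.
  rewrite invr_ge0 powR_ge0 /= lef_pV2 ?posrE ?powR_gt0 ?subr_gt0 //.
  by rewrite ge0_ler_powR ?nnegrE ?divr_ge0 ?subr_ge0 ?lerD2l ?lerN2
    ?(ltW w2_lt1) ?(ltW mw2_lt1).
split; first exact: le_lt_trans (cabsM_le mu w mu_le1) w_lt1.
have real_div (u : R[i]) (r : R) : u / r%:C%C = (r^-1)%:C%C * u.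
  by rewrite fmorphV mulrC.
have Omcz : Om (fun j => (c j)%:C%C * z j, z') by under eq_fun do rewrite -real_div.
have := star_hartogs_z_shrink lam_le1 c_gt0 d_le_c Omcz.
by under eq_fun do rewrite -real_div.
Qed.

Lemma star_hartogs_zw_Vgamma (gamma : 'I_n -> R) :
  (forall j, 0 <= gamma j) -> star_hartogs_zw (Vgamma Om gamma).
Proof.
move=> gamma_ge0 z z' w lam mu lam_le1 mu_le1 Omz.
have mw2_le := sqr_cabsM_le mu w mu_le1.
pose c j := expR (gamma j * cabs w ^+ 2 / 2).
pose d j := expR (gamma j * cabs (mu * w) ^+ 2 / 2).
have c_gt0 j : 0 < c j by exact: expR_gt0.
have d_le_c j : 0 <= d j <= c j.
  by rewrite expR_ge0 ler_expR ler_wpM2r ?invr_ge0 ?ler_wpM2l.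
exact: star_hartogs_z_shrink lam_le1 c_gt0 d_le_c Omz.
Qed.

End StarHartogs.

Theorem lemma3p1 (R : realType) (n m : nat) (Om : set (pt R n m))
    (alpha gamma : 'I_n -> R) :
  cdomain Om -> star_hartogs_z Om ->
  (forall j, 0 < alpha j) -> (forall j, 0 < gamma j) ->
  star_hartogs_zw (Ualpha Om alpha) /\ star_hartogs_zw (Vgamma Om gamma).
Proof.
move=> _ Om_star alpha_gt0 gamma_gt0; split.
- by apply: (star_hartogs_zw_Ualpha Om_star) => j; exact: ltW.
- by apply: (star_hartogs_zw_Vgamma Om_star) => j; exact: ltW.
Qed.
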